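(* Let $R$ be an associative ring (not necessarily unital) and let $\operatorname{Nil}(R)$ denote its set of nilpotent elements. The following are equivalent: (i) $\operatorname{Nil}(R)$ is additively closed; (ii) $\operatorname{Nil}(R)$ is multiplicatively closed and $R$ satisfies Köthe's conjecture; (iii) $\operatorname{Nil}(R)$ is closed under the operation $x\circ y=x+y-xy$; (iv) $\operatorname{Nil}(R)$ is a subring of $R$.
   Context: Rings are associative and not necessarily unital. A ring $R$ is said to satisfy Köthe's conjecture if every nil left ideal of $R$ is contained in a nil two-sided ideal of $R$ (equivalently, the sum of two nil left ideals of $R$ is a nil left ideal). For $x,y\in R$, $x\circ y=x+y-xy$. *)

(* Defs.v *)
(* Non-unital associative rings are not in MathComp (all its
   ring structures have a 1), so a ring is an additive group (zmodType) with
   an explicit associative, bi-distributive multiplication [mul]. *)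
From mathcomp Require Import all_boot all_algebra.
Set Implicit Arguments. Unset Strict Implicit. Unset Printing Implicit Defensive.
Import GRing.Theory.
Local Open Scope ring_scope.

Section NonUnital.
Variables (R : zmodType) (mul : R -> R -> R).

Definition nu_ring_axioms : Prop :=
  associative mul /\ left_distributive mul +%R /\ right_distributive mul +%R.

(* npow x n = x^(n+1) *)
Definition npow (x : R) (n : nat) : R := iter n (mul x) x.

Definition nilpotent (x : R) : Prop := exists n : nat, npow x n = 0.

Definition add_subgroup (I : R -> Prop) : Prop :=
  I 0 /\ (forall x y, I x -> I y -> I (x - y)).

Definition left_ideal (I : R -> Prop) : Prop :=
  add_subgroup I /\ (forall r x, I x -> I (mul r x)).

Definition two_sided_ideal (I : R -> Prop) : Prop :=
  left_ideal I /\ (forall r x, I x -> I (mul x r)).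

Definition nil_set (I : R -> Prop) : Prop := forall x, I x -> nilpotent x.

Definition koethe : Prop :=
  forall I, left_ideal I -> nil_set I ->
    exists J, two_sided_ideal J /\ nil_set J /\ (forall x, I x -> J x).

Definition circ (x y : R) : R := x + y - mul x y.

Definition nil_add_closed : Prop :=
  forall x y, nilpotent x -> nilpotent y -> nilpotent (x + y).
Definition nil_mul_closed : Prop :=
  forall x y, nilpotent x -> nilpotent y -> nilpotent (mul x y).
Definition nil_circ_closed : Prop :=
  forall x y, nilpotent x -> nilpotent y -> nilpotent (circ x y).
Definition nil_subring : Prop :=
  nilpotent 0 /\
  (forall x y, nilpotent x -> nilpotent y -> nilpotent (x - y)) /\
  (forall x y, nilpotent x -> nilpotent y -> nilpotent (x + y)) /\
  nil_mul_closed.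
End NonUnital.

(* Main.v *)
(** Write [N] for the set of nilpotent elements and [U] for the set of [u] such
    that [uR] is nil.  Each of (i), (ii), (iii) implies that [U] is a (nil)
    two-sided ideal and that [ef] is nilpotent whenever [e^2] and [f^2] lie
    in [U].  Conversely these two facts force [N] to be a subring.

    The key step is that [qp] in [U] and [b] in [N] imply [qbp] in [U].  Every
    [e = prq] is square-zero modulo [U], and so is its conjugate
    [e' = (1-b)e(1-b)^-1]; hence [ee'] is nilpotent.  By induction on the
    nilpotency index of [b], [e b^k e] lies in [U] for [k >= 2], so that [ee']
    is, up to sign, cyclic rotation and [U], equal to [(eb)^2].  Thus [prqb] is
    nilpotent for all [r], i.e. [qbp] is in [U].

    Consequently the sets [Q_k = {q | q a^k in U}] are stable under right
    multiplication by [N], and [Q_(k+1) a] is contained in [Q_k].  If [a^n = 0]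
    then [Q_n = R], and a product of elements of [N] with [n] factors [a] lies
    in [Q_0 = U]. *)
Require Import Defs.
From mathcomp Require Import all_boot all_algebra.
From mathcomp Require Import zify.
Set Implicit Arguments. Unset Strict Implicit. Unset Printing Implicit Defensive.
Import GRing.Theory.
Local Open Scope ring_scope.

Lemma eq_of_sub_add0 (V : zmodType) (x y : V) : x - y + 0 = 0 -> x = y.
Proof. by rewrite addr0 => /eqP; rewrite subr_eq0 => /eqP. Qed.

(* Decides equations between linear combinations of syntactic atoms, by
   cancelling the leading summand of the difference against its opposite. *)
Ltac zmod_cancel :=
  apply: eq_of_sub_add0; rewrite ?(opprD, opprK, oppr0, subr0, sub0r, add0r, addr0);
  rewrite ?(opprD, opprK); try (rewrite -[LHS]addr0); rewrite -?addrA;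
  repeat match goal with
  | |- - ?t + _ = 0 => rewrite ?(addrCA _ t) ?addrK ?addKr ?addNKr
  | |- ?t + _ = 0 => rewrite ?(addrCA _ (- t)) ?addKr ?addNKr
  end; try reflexivity.

Section NonUnitalRing.
Variables (R : zmodType) (mul : R -> R -> R).
Context (HR : nu_ring_axioms mul).
Local Notation "x ** y" := (mul x y) (at level 40, left associativity).
Local Notation N := (nilpotent mul).
Local Notation pow := (npow mul).

(** * Arithmetic and nilpotency without a unit *)

Lemma numulA x y z : x ** (y ** z) = x ** y ** z.
Proof. by case: HR => ->. Qed.
Lemma numulDl x y z : (x + y) ** z = x ** z + y ** z.
Proof. by case: HR => _ [-> _]. Qed.
Lemma numulDr x y z : x ** (y + z) = x ** y + x ** z.
Proof. by case: HR => _ [_ ->]. Qed.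
Lemma numul0r x : 0 ** x = 0.
Proof. by apply: (addrI (0 ** x)); rewrite -numulDl !addr0. Qed.
Lemma numulr0 x : x ** 0 = 0.
Proof. by apply: (addrI (x ** 0)); rewrite -numulDr !addr0. Qed.
Lemma numulNr x y : (- x) ** y = - (x ** y).
Proof. by apply: (addrI (x ** y)); rewrite -numulDl !subrr numul0r. Qed.
Lemma numulrN x y : x ** (- y) = - (x ** y).
Proof. by apply: (addrI (x ** y)); rewrite -numulDr !subrr numulr0. Qed.

Ltac nuring :=
  rewrite ?(numulDl, numulDr, numulNr, numulrN, numul0r, numulr0);
  rewrite -?numulA; zmod_cancel.

Lemma npowS x n : pow x n.+1 = x ** pow x n.
Proof. by []. Qed.

Lemma npowD x m n : pow x m ** pow x n = pow x (m + n).+1.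
Proof. by elim: m => [|m IH] //; rewrite npowS -numulA IH. Qed.

Lemma npowSr x n : pow x n.+1 = pow x n ** x.
Proof. by rewrite -[x in RHS]/(pow x 0) npowD addn0. Qed.

Lemma npow_npow x m n : pow (pow x m) n = pow x (m.+1 * n.+1).-1.
Proof.
elim: n => [|n IH]; first by rewrite muln1.
by rewrite npowS IH npowD; congr (npow _ _ _); lia.
Qed.

Lemma nil_npow x n : N (pow x n) -> N x.
Proof. by case=> k; rewrite npow_npow => xk; exists (n.+1 * k.+1).-1. Qed.

Lemma nil_sqr x : N x -> N (x ** x).
Proof.
case=> k xk; exists k; rewrite -[x ** x]/(pow x 1) npow_npow.
have -> : (2 * k.+1).-1 = (k + k).+1 by lia.
by rewrite -npowD xk numulr0.
Qed.

Lemma nil0 : N 0.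
Proof. by exists 0%N. Qed.

Lemma nilN x : N x -> N (- x).
Proof.
case=> n xn; exists n.
have : pow (- x) n = pow x n \/ pow (- x) n = - pow x n.
  elim: n {xn} => [|n [] IH]; first by right.
  - by right; rewrite npowS IH numulNr.
  - by left; rewrite npowS IH numulNr numulrN opprK.
by rewrite xn oppr0; case.
Qed.

Lemma nil_mulC x y : N (x ** y) -> N (y ** x).
Proof.
case=> n xyn; exists n.+1.
suff -> : pow (y ** x) n.+1 = y ** (pow (x ** y) n ** x) by rewrite xyn numul0r numulr0.
elim: n {xyn} => [|n IH]; first by rewrite /npow /= !numulA.
by rewrite npowS IH !npowS !numulA.
Qed.

(* [(1 + s) y] and [y (1 + s)], with [1 + s] in the unital hull of [R]. *)
Lemma nil_unital_mulC s y : N (y + y ** s) -> N (y + s ** y).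
Proof.
case=> k wk; exists k.+1; rewrite npowS.
suff yw : y ** pow (y + s ** y) k = pow (y + y ** s) k ** y.
  by rewrite numulDl -numulA yw wk numul0r numulr0 addr0.
elim: k {wk} => [|k IH]; first by rewrite /npow /=; nuring.
by rewrite !npowS -numulA -IH; nuring.
Qed.

(** * Congruences modulo a two-sided ideal *)

Section Ideal.
Variable J : R -> Prop.
Context (idJ : two_sided_ideal mul J).

Lemma ideal0 : J 0. Proof. by case: idJ => [[[]]]. Qed.
Lemma idealB x y : J x -> J y -> J (x - y).
Proof. by case: idJ => [[[_ h] _] _]; apply: h. Qed.
Lemma idealN x : J x -> J (- x).
Proof. by move=> Jx; rewrite -sub0r; apply: idealB => //; apply: ideal0. Qed.
Lemma idealD x y : J x -> J y -> J (x + y).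
Proof. by move=> Jx Jy; rewrite -[y]opprK; apply: idealB => //; apply: idealN. Qed.
Lemma ideal_mull r x : J x -> J (r ** x).
Proof. by case: idJ => [[_ h] _]; apply: h. Qed.
Lemma ideal_mulr r x : J x -> J (x ** r).
Proof. by case: idJ => [_ h]; apply: h. Qed.

Lemma ideal_cong x y : J (x - y) -> J x -> J y.
Proof. by move=> Jxy Jx; rewrite -[y](subKr x); apply: idealB. Qed.

Lemma ideal_npow_cong x y n : J (x - y) -> J (pow x n - pow y n).
Proof.
move=> Jxy; elim: n => [|n IH] //; rewrite !npowS.
have -> : x ** pow x n - y ** pow y n =
          (x - y) ** pow x n + y ** (pow x n - pow y n) by nuring.
by apply: idealD; [apply: ideal_mulr | apply: ideal_mull].
Qed.

Lemma ideal_npow_leq x m n : (m <= n)%N -> J (pow x m) -> J (pow x n).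
Proof.
move=> /subnK <- Jxm; elim: (n - m)%N => [|d IH] //.
by rewrite addSn npowS; apply: ideal_mull.
Qed.

Lemma nil_cong x y : nil_set mul J -> J (x - y) -> N x -> N y.
Proof.
move=> nilJ Jxy [n xn]; apply: (@nil_npow _ n); apply: nilJ.
by apply: (ideal_cong (ideal_npow_cong n Jxy)); rewrite xn; apply: ideal0.
Qed.

End Ideal.

(** * The set [U] and the two facts about it *)

Definition nil_radical (u : R) : Prop := forall r, N (u ** r).
Local Notation U := nil_radical.

Definition nil_radical_add_closed : Prop := forall u v, U u -> U v -> U (u + v).
Definition nil_square_zero_mul : Prop :=
  forall e f, U (e ** e) -> U (f ** f) -> N (e ** f).

Lemma nil_radical_nil : nil_set mul U.
Proof. by move=> u Uu; apply: (@nil_npow _ 1); apply: Uu. Qed.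

(** Only sums need the hypothesis: [s ** u ** r] is a rotation of [u ** (r ** s)]. *)
Lemma nil_radical_ideal : nil_radical_add_closed -> two_sided_ideal mul U.
Proof.
move=> UD; split; last by move=> r u Uu s; rewrite -numulA; apply: Uu.
split; last first.
  by move=> s u Uu r; rewrite -numulA; apply: nil_mulC; rewrite -numulA; apply: Uu.
split; first by move=> r; rewrite numul0r; apply: nil0.
move=> u v Uu Uv; apply: UD => // r; rewrite numulNr; exact: nilN.
Qed.

(** When [pow b n = 0], [1 + geom b n] is the inverse of [1 - b] in the unital hull. *)
Definition geom (b : R) (n : nat) : R := \sum_(i < n.+1) pow b i.

Lemma geom0 b : geom b 0 = b.
Proof. by rewrite /geom big_ord1. Qed.
Lemma geomS b n : geom b n.+1 = geom b n + pow b n.+1.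
Proof. by rewrite /geom big_ord_recr. Qed.

Lemma geomSr b n : geom b n.+1 = b + geom b n ** b.
Proof.
elim: n => [|n IH]; first by rewrite geomS geom0.
by rewrite geomS {1}IH geomS numulDl addrA -npowSr.
Qed.

Lemma geom_mulr b n : geom b n - b - geom b n ** b = - pow b n.+1.
Proof. by rewrite -addrA -opprD -geomSr geomS opprD addrA subrr sub0r. Qed.

Lemma geom_mull b n : geom b n - b - b ** geom b n = - pow b n.+1.
Proof.
rewrite -geom_mulr; congr (_ - _).
elim: n => [|n IH]; first by rewrite geom0.
by rewrite !geomS numulDl numulDr IH -npowSr npowS.
Qed.

(** * The two facts make the nilpotents a subring *)

Section Radical.
Context (UD : nil_radical_add_closed) (sqN : nil_square_zero_mul).
Let idU := nil_radical_ideal UD.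
Let N_cong x y := @nil_cong U idU x y nil_radical_nil.

Lemma nil_radical_insert_npow m b : U (pow b m) ->
  forall q p, U (q ** p) -> U (q ** b ** p).
Proof.
elim: m b => [|m IH] b Ubm q p Uqp.
  by apply: (ideal_mulr idU); apply: (ideal_mull idU).
(* [pow b k.+1] is b^(k+2), at least a square, so its index modulo [U] has dropped and [IH]
   applies. *)
have Upow k q' p' : U (q' ** p') -> U (q' ** pow b k.+1 ** p').
  apply: IH; rewrite npow_npow.
  by apply: (ideal_npow_leq idU _ Ubm); lia.
pose s := geom b m.+1.
have Us : U (s - b - s ** b).
  by rewrite geom_mulr npowS; apply: (idealN idU); apply: (ideal_mull idU).
have Usb q' p' : U (q' ** p') -> U (q' ** (s - b) ** p').
  move=> Uq; rewrite /s; elim: m.+1 => [|n IHn].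
    by rewrite geom0 subrr numulr0 numul0r; apply: (ideal0 idU).
  rewrite geomS addrAC numulDr numulDl; apply: (idealD idU) => //; exact: Upow.
move=> r; rewrite -numulA; apply: nil_mulC; rewrite numulA.
set e := p ** r ** q.
have Ue : U (e ** e).
  have -> : e ** e = (p ** r) ** (q ** p) ** (r ** q) by rewrite /e !numulA.
  by apply: (ideal_mulr idU); apply: (ideal_mull idU).
(* This is (1-b)e(1+s), and [Us] says that (1+s)(1-b) is 1 modulo [U]. *)
pose e' := e + e ** s - b ** e - b ** e ** s.
have Ue' : U (e' ** e').
  have -> : e' ** e' =
    (e - b ** e) ** (s - b - s ** b) ** (e + e ** s) + (e ** e + e ** e ** s - b ** (e ** e) - b ** (e ** e) ** s).
    by rewrite /e'; nuring.
  apply: (idealD idU).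
    by apply: (ideal_mulr idU); apply: (ideal_mull idU).
  have Ubee : U (b ** (e ** e)) by apply: (ideal_mull idU).
  apply: (idealB idU); last by apply: (ideal_mulr idU).
  by apply: (idealB idU) => //; apply: (idealD idU) => //; apply: (ideal_mulr idU).
have Nebe : N (e ** b ** (e + e ** s)).
  rewrite -[_ ** _]opprK; apply: nilN; apply: (@N_cong (e ** e')); last exact: sqN.
  have -> : e ** e' - - (e ** b ** (e + e ** s)) = e ** e + e ** e ** s.
    by rewrite /e'; nuring.
  by apply: (idealD idU) => //; apply: (ideal_mulr idU).
(* After rotation, [s] may be replaced by [b], because [e ** (s - b) ** e] lies in [U] by [Usb]. *)
apply: (@nil_npow _ 1); rewrite /npow /=; apply: N_cong (nil_mulC Nebe).
have -> : (e + e ** s) ** (e ** b) - e ** b ** (e ** b) =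
          e ** e ** b + e ** (s - b) ** e ** b by nuring.
by apply: (idealD idU); apply: (ideal_mulr idU) => //; apply: Usb.
Qed.

Lemma nil_radical_insert b q p : N b -> U (q ** p) -> U (q ** b ** p).
Proof.
by case=> m bm; apply: (@nil_radical_insert_npow m); rewrite bm; apply: (ideal0 idU).
Qed.

(* [ann a k q] says that [q a^k] lies in the radical. *)
Fixpoint ann (a : R) (k : nat) (q : R) : Prop :=
  if k is k'.+1 then ann a k' (q ** a) else U q.

Lemma annE a k q : ann a k.+1 q <-> U (q ** pow a k).
Proof. by elim: k q => [|k IH] q //; rewrite npowS numulA -IH. Qed.

Lemma annD a k q q' : ann a k q -> ann a k q' -> ann a k (q + q').
Proof.
elim: k q q' => [|k IH] q q' /=; first exact: UD.
by rewrite numulDl; apply: IH.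
Qed.

Lemma ann_mulr a b k q : N b -> ann a k q -> ann a k (q ** b).
Proof.
move=> Nb; case: k => [|k]; first exact: (ideal_mulr idU).
by move=> /annE Hq; apply/annE; apply: nil_radical_insert.
Qed.

Lemma ann_mul_npow a b k q n : N b -> ann a k q -> ann a k (q ** pow b n).
Proof.
move=> Nb Hq; elim: n => [|n IH]; first exact: ann_mulr.
by rewrite npowSr numulA; apply: ann_mulr.
Qed.

(** Each factor [w] descends one step of the chain Q_k, which starts at Q_(n+1) = R and ends at Q_0
    = [U]. *)
Lemma nil_of_ann a w : N a ->
  (forall k q, ann a k.+1 q -> ann a k (q ** w)) -> N w.
Proof.
move=> [n an] Hw.
have Hiter k : forall q, ann a k q -> U (iter k (mul^~ w) q).
  by elim: k => [|k IH] q // Hq; rewrite iterSr; apply/IH/Hw.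
apply: (@nil_npow _ n.+1); apply: nil_radical_nil.
have -> : pow w n.+1 = iter n.+1 (mul^~ w) w.
  by elim: n.+1 => [|j IH] //; rewrite npowSr IH iterS.
by apply: Hiter; apply/annE; rewrite an numulr0; apply: (ideal0 idU).
Qed.

Lemma nil_mul_closed_of_radical : nil_mul_closed mul.
Proof.
move=> a b Na Nb; apply: (nil_of_ann Na) => k q Hq.
by rewrite numulA; apply: ann_mulr.
Qed.

Lemma nil_add_closed_of_radical : nil_add_closed mul.
Proof.
move=> a b Na Nb; have [m bm] := Nb.
apply: (@nil_npow _ m); apply: (nil_of_ann Na) => k q Hq.
(* Expanded, the difference consists of [q] times words with at least one factor [a], and one such
   factor already leads from Q_(k+1) to Q_k. *)
suff : ann a k (q ** pow (a + b) m - q ** pow b m) by rewrite bm numulr0 subr0.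
elim: m {bm} => [|m IH].
  by have -> : q ** pow (a + b) 0 - q ** pow b 0 = q ** a by rewrite /npow /=; nuring.
have -> : q ** pow (a + b) m.+1 - q ** pow b m.+1 =
  (q ** pow (a + b) m - q ** pow b m) ** a +
  (q ** pow (a + b) m - q ** pow b m) ** b + q ** pow b m ** a.
  by rewrite !npowSr; nuring.
apply: annD; last exact: (@ann_mul_npow a b k.+1).
by apply: annD; apply: ann_mulr.
Qed.

End Radical.

(** * Consequences of (i) *)

Section AddClosed.
Context (NadD : nil_add_closed mul).

Lemma nil_add_closed_radical : nil_radical_add_closed.
Proof. by move=> u v Uu Uv r; rewrite numulDl; apply: NadD. Qed.

(** Modulo [U], [v = ef + fe] equals (e+f)^2, hence is nilpotent. For [x = ef], [v ** x] is x^2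
    modulo [U], so powers of [v] applied to [x] are powers of [x]. *)
Lemma nil_add_closed_square_zero : nil_square_zero_mul.
Proof.
move=> e f Ue Uf; have idU := nil_radical_ideal nil_add_closed_radical.
have nilsq g : U (g ** g) -> N g.
  by move=> Ug; apply: (@nil_npow _ 1); apply: nil_radical_nil.
pose v := e ** f + f ** e; set x := e ** f.
have [n vn] : N v.
  apply: (nil_cong idU nil_radical_nil _ (nil_sqr (NadD (nilsq _ Ue) (nilsq _ Uf)))).
  have -> : (e + f) ** (e + f) - v = e ** e + f ** f by rewrite /v; nuring.
  exact: (idealD idU).
have Uvx w : U ((v - x) ** (x ** w)).
  have -> : (v - x) ** (x ** w) = f ** (e ** e) ** (f ** w).
    by rewrite /v /x; nuring.
  by apply: (ideal_mulr idU); apply: (ideal_mull idU).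
have Uvn : U (pow v n ** x - pow x n.+1).
  elim: n {vn} => [|n IH].
    rewrite npowS /npow /= -[v ** x - _]/(v ** x - x ** x).
    have -> : v ** x - x ** x = f ** (e ** e) ** f by rewrite /v /x; nuring.
    by apply: (ideal_mulr idU); apply: (ideal_mull idU).
  have -> : pow v n.+1 ** x - pow x n.+2 =
    v ** (pow v n ** x - pow x n.+1) + (v - x) ** (x ** pow x n).
    by rewrite !npowS; nuring.
  by apply: (idealD idU) => //; apply: (ideal_mull idU).
apply: (@nil_npow _ n.+1); apply: nil_radical_nil.
by apply: (ideal_cong idU Uvn); rewrite vn numul0r; apply: (ideal0 idU).
Qed.

Lemma nil_add_closed_mul_closed : nil_mul_closed mul.
Proof.
exact: (nil_mul_closed_of_radical nil_add_closed_radical nil_add_closed_square_zero).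
Qed.

(** [U] serves for every nil left ideal [L]: for [x] in [L], [x ** r] is a rotation of [r ** x],
    which is in [L]. *)
Lemma nil_add_closed_koethe : koethe mul.
Proof.
move=> L [_ LM] nilL; exists U; split; last split.
- exact: (nil_radical_ideal nil_add_closed_radical).
- exact: nil_radical_nil.
- by move=> x Lx r; apply: nil_mulC; apply: nilL; apply: LM.
Qed.

End AddClosed.

(** * The two facts from (ii) *)

Lemma koethe_radical : koethe mul -> nil_radical_add_closed.
Proof.
move=> K.
have nil_ideal u r : U u -> exists J,
    two_sided_ideal mul J /\ nil_set mul J /\ J (r ** u).
  move=> Uu; have [||J [idJ [nilJ LJ]]] := K (fun x => exists s, x = s ** u).
  - split; last by move=> s x [t ->]; exists (s ** t); rewrite numulA.
    split; first by exists 0; rewrite numul0r.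
    by move=> x y [s ->] [t ->]; exists (s - t); rewrite numulDl numulNr.
  - by move=> x [s ->]; apply: nil_mulC; apply: Uu.
  - by exists J; split=> //; split=> //; apply: LJ; exists r.
(* Köthe's conjecture is applied to [R v] alone: modulo the resulting nil ideal, [r ** u + r ** v]
   is [r ** u]. *)
move=> u v Uu Uv r; apply: nil_mulC; rewrite numulDr.
have [J [idJ [nilJ Jrv]]] := nil_ideal v r Uv.
apply: (nil_cong idJ nilJ _ (nil_mulC (Uu r))).
by rewrite opprD addrA subrr sub0r; apply: (idealN idJ).
Qed.

Lemma nil_mul_closed_square_zero : nil_mul_closed mul -> nil_square_zero_mul.
Proof.
by move=> NM e f Ue Uf; apply: NM; apply: (@nil_npow _ 1); apply: nil_radical_nil.
Qed.

(** * The two facts from (iii) *)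

Section CircClosed.
Context (Ncirc : nil_circ_closed mul).

(* [1 - x - y = (1 - x)(1 - (1 - x)^-1 y)] for [x = ur], [y = vr]. *)
Lemma nil_circ_closed_radical : nil_radical_add_closed.
Proof.
move=> u v Uu Uv r; rewrite numulDl; have [n xn] := Uu r.
set x := u ** r in xn *; set y := v ** r; set s := geom x n.
have -> : x + y = circ mul x (y + s ** y).
  have sx : s - x - x ** s = 0 by rewrite geom_mull npowS xn numulr0 oppr0.
  apply/eqP; rewrite -subr_eq0 -oppr_eq0 /circ.
  by rewrite -(numul0r y) -sx; apply/eqP; nuring.
apply: Ncirc; first exact: Uu.
(* The rotation moves 1+s to the right of [y], where it is absorbed into a right multiple of [v]. *)
apply: nil_unital_mulC.
have -> : y + y ** s = v ** (r + r ** s) by rewrite /y; nuring.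
exact: Uv.
Qed.

(* With [z = e o f] and [x = ef], modulo the radical [ez = x] and
   [x e w = e z^2 w + x e z w], so that nilpotency of [z] climbs down to
   [x^k e z = 0] for some [k]. *)
Lemma nil_circ_closed_square_zero : nil_square_zero_mul.
Proof.
move=> e f Ue Uf; have idU := nil_radical_ideal nil_circ_closed_radical.
have nilsq g : U (g ** g) -> N g.
  by move=> Ug; apply: (@nil_npow _ 1); apply: nil_radical_nil.
have [m zm] := Ncirc (nilsq _ Ue) (nilsq _ Uf).
set z := circ mul e f in zm; set x := e ** f.
have zE : z = e + f - x by [].
have iterB k g h : iter k (mul x) (g - h) = iter k (mul x) g - iter k (mul x) h.
  by elim: k => [|k IH] //=; rewrite IH numulDr numulrN.
have iterD k g h : iter k (mul x) (g + h) = iter k (mul x) g + iter k (mul x) h.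
  by elim: k => [|k IH] //=; rewrite IH numulDr.
have iterU k g : U g -> U (iter k (mul x) g).
  by move=> Ug; elim: k => [|k IH] //=; apply: (ideal_mull idU).
(* Two conditions are carried because the relation for [x e w] is of second order in [z]. *)
pose S w := exists k, U (iter k (mul x) (e ** w)) /\ U (iter k (mul x) (e ** (z ** w))).
have Sdown w : S (z ** w) -> S w.
  move=> [k [U1 U2]]; exists k.+1; split; last by rewrite iterS; apply: (ideal_mull idU).
  have U3 : U (iter k (mul x) (e ** (z ** (z ** w)) + x ** (e ** (z ** w)) - x ** (e ** w))).
    apply: iterU.
    have -> : e ** (z ** (z ** w)) + x ** (e ** (z ** w)) - x ** (e ** w) =
      e ** e ** (z ** w - f ** (z ** w)) + x ** (e ** e) ** (w - f ** w) +
      e ** (f ** f) ** w by rewrite zE /x; nuring.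
    by do 2?apply: (idealD idU); apply: (ideal_mulr idU) => //; apply: (ideal_mull idU).
  rewrite iterB in U3; rewrite iterSr; apply: (ideal_cong idU U3).
  rewrite iterD; apply: (idealD idU) => //.
  by rewrite -iterSr iterS; apply: (ideal_mull idU).
(* Descend from [pow z m = 0], where [S] is trivial. Stopping at [z] suffices, as [e ** z] is [x]
   modulo [U]. *)
have [k [Uk _]] : S z.
  suff : S (pow z m) by elim: m {zm} => [|m IH] // /Sdown.
  by rewrite zm; exists 0%N; rewrite !numulr0; split; apply: (ideal0 idU).
apply: (@nil_npow _ k); apply: nil_radical_nil.
have Uezx : U (e ** z - x).
  have -> : e ** z - x = e ** e - e ** e ** f by rewrite zE /x; nuring.
  by apply: (idealB idU) => //; apply: (ideal_mulr idU).
by apply: (ideal_cong idU _ Uk); rewrite /npow -iterB; apply: iterU.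
Qed.

End CircClosed.
End NonUnitalRing.

Theorem theorem2p6 (R : zmodType) (mul : R -> R -> R)
  (HR : nu_ring_axioms mul) :
  (nil_add_closed mul <-> (nil_mul_closed mul /\ koethe mul)) /\
  (nil_add_closed mul <-> nil_circ_closed mul) /\
  (nil_add_closed mul <-> nil_subring mul).
Proof.
split; last split; split.
- by move=> Nadd; split; [apply: nil_add_closed_mul_closed | apply: nil_add_closed_koethe].
- case=> Nmul K; apply: (nil_add_closed_of_radical HR); first exact: koethe_radical.
  exact: nil_mul_closed_square_zero.
- move=> Nadd x y Nx Ny; apply: (Nadd _ _ (Nadd _ _ Nx Ny)); apply: (nilN HR).
  exact: nil_add_closed_mul_closed.
- move=> Ncirc; apply: (nil_add_closed_of_radical HR).
    exact: nil_circ_closed_radical.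
  exact: nil_circ_closed_square_zero.
- move=> Nadd; split; first exact: nil0.
  split; first by move=> x y Nx Ny; apply: (Nadd _ _ Nx); apply: (nilN HR).
  by split=> //; apply: nil_add_closed_mul_closed.
- by case=> _ [_ []].
Qed.
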